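(* Let $\mathbb G=(V,E)$ be a directed graph with no isolated vertices and with every in-degree and every out-degree at most one. Then $$S_{\mathbb G}\in\mathsf V(M_2(S_7)).$$ More precisely, $S_{\mathbb G}$ is a homomorphic image of a subsemiring of the direct power $M_2(S_7)^{\Lambda}$, where $\Lambda=\{0,1\}^{V}$ is the set of all binary labellings of the vertices.
   Context: An additively idempotent semiring (ai-semiring) is an algebra $(S,+,\cdot)$ with $(S,+)$ a commutative idempotent semigroup, $(S,\cdot)$ a semigroup, and multiplication distributing over addition on both sides. $\mathsf V(S)$ denotes the variety generated by $S$. $S_7=\{1,a,\infty\}$ is the ai-semiring with addition $x+x=x$ and $x+y=\infty$ for $x\ne y$, and with commutative multiplication $1\cdot 1=1$, $1\cdot a=a\cdot 1=a$, $a\cdot a=\infty$, $x\cdot\infty=\infty\cdot x=\infty$. $M_2(S_7)$ is the ai-semiring of all $2\times2$ matrices over $S_7$ with entrywise addition and usual matrix multiplication. Graph semiring: for a directed graph $\mathbb G=(V,E)$ as in the claim (loops are allowed), $S_{\mathbb G}=V\,\dot\cup\,\{0,\omega\}$. Its addition is flat: $x+x=x$, and the sum of two distinct elements is $0$. Its multiplication is given, for vertices $u,v$, by $uv=\omega$ if $(u,v)\in E$ and $uv=0$ if $(u,v)\notin E$, while every product involving $0$ or $\omega$ is $0$. *)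

(* Defs.v *)
From HB Require Import structures.
From mathcomp Require Import all_boot all_order all_algebra.
From mathcomp Require Import boolp classical_sets functions cardinality.

Set Implicit Arguments.
Unset Strict Implicit.
Unset Printing Implicit Defensive.

Local Open Scope classical_set_scope.
Local Open Scope card_scope.
Local Open Scope group_scope.
Local Open Scope ring_scope.

(* MathComp's semirings have a neutral zero, ai-semirings need not.  Addition
   is that of the commutative addSemigroupType and multiplication, written
   [(x * y)%g], that of semigroupType; no neutral elements are assumed. *)
HB.mixin Record isAiSemiring S of Algebra.AddSemigroup S & Semigroup S := {
  addxx : idempotent_op (@Algebra.add S);
  ai_mulDl : forall x y z : S, ((x + y)%R * z)%g = (x * z)%g + (y * z)%g;
  ai_mulDr : forall x y z : S, (x * (y + z)%R)%g = (x * y)%g + (x * z)%g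
}.

#[short(type="aiSemiringType")]
HB.structure Definition AiSemiring :=
  {S of isAiSemiring S & Algebra.AddSemigroup S & Semigroup S}.

Definition ai_morphism (S T : aiSemiringType) (f : S -> T) : Prop :=
  {morph f : x y / x + y} /\ {morph f : x y / (x * y)%g}.

Definition hom_image (S T : aiSemiringType) : Prop :=
  exists f : S -> T, ai_morphism f /\ range f = [set: T].

Record subsemiring (S : aiSemiringType) := Subsemiring {
  subsemiring_set :> set S;
  subsemiring_addP : forall x y,
    subsemiring_set x -> subsemiring_set y -> subsemiring_set (x + y);
  subsemiring_mulP : forall x y,
    subsemiring_set x -> subsemiring_set y -> subsemiring_set (x * y)%g
}.

Section SubsemiringType.
Variables (S : aiSemiringType) (B : subsemiring S).

Definition subsemiring_type : Type := set_type (subsemiring_set B).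

HB.instance Definition _ := Choice.on subsemiring_type.

Implicit Types x y z : subsemiring_type.

Lemma subsemiring_valP x : subsemiring_set B (val x).
Proof. exact: set_mem (valP x). Qed.

Definition subsemiring_add x y : subsemiring_type :=
  exist _ (val x + val y) (mem_set
    (subsemiring_addP (subsemiring_valP x) (subsemiring_valP y))).

Definition subsemiring_mul x y : subsemiring_type :=
  exist _ (val x * val y)%g (mem_set
    (subsemiring_mulP (subsemiring_valP x) (subsemiring_valP y))).

Lemma subsemiring_addC : commutative subsemiring_add.
Proof. by move=> x y; apply: val_inj; exact: Algebra.addrC. Qed.
Lemma subsemiring_addA : associative subsemiring_add.
Proof. by move=> x y z; apply: val_inj; exact: Algebra.addrA. Qed.
Lemma subsemiring_mulA : associative subsemiring_mul.
Proof. by move=> x y z; apply: val_inj; exact: mulgA. Qed.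

HB.instance Definition _ :=
  Algebra.isAddSemigroup.Build subsemiring_type
    subsemiring_addC subsemiring_addA.
HB.instance Definition _ :=
  isSemigroup.Build subsemiring_type subsemiring_mulA.

Fact subsemiring_addxx : idempotent_op (@Algebra.add subsemiring_type).
Proof. by move=> x; apply: val_inj; exact: addxx. Qed.
Fact subsemiring_mulDl (x y z : subsemiring_type) :
  ((x + y)%R * z)%g = (x * z)%g + (y * z)%g.
Proof. by apply: val_inj; exact: ai_mulDl. Qed.
Fact subsemiring_mulDr (x y z : subsemiring_type) :
  (x * (y + z)%R)%g = (x * y)%g + (x * z)%g.
Proof. by apply: val_inj; exact: ai_mulDr. Qed.

HB.instance Definition _ := isAiSemiring.Build subsemiring_type
  subsemiring_addxx subsemiring_mulDl subsemiring_mulDr.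

End SubsemiringType.

Section Product.
Variables (I : Type) (S : I -> aiSemiringType).

Definition ai_prod : Type := forall i, S i.

HB.instance Definition _ := Choice.on ai_prod.

Definition ai_prod_add (f g : ai_prod) : ai_prod := fun i => f i + g i.
Definition ai_prod_mul (f g : ai_prod) : ai_prod := fun i => (f i * g i)%g.

Lemma ai_prod_addC : commutative ai_prod_add.
Proof. by move=> f g; apply: functional_extensionality_dep => i; exact: Algebra.addrC. Qed.
Lemma ai_prod_addA : associative ai_prod_add.
Proof. by move=> f g h; apply: functional_extensionality_dep => i; exact: Algebra.addrA. Qed.
Lemma ai_prod_mulA : associative ai_prod_mul.
Proof. by move=> f g h; apply: functional_extensionality_dep => i; exact: mulgA. Qed.

HB.instance Definition _ :=
  Algebra.isAddSemigroup.Build ai_prod ai_prod_addC ai_prod_addA.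
HB.instance Definition _ := isSemigroup.Build ai_prod ai_prod_mulA.

Fact ai_prod_addxx : idempotent_op (@Algebra.add ai_prod).
Proof. by move=> f; apply: functional_extensionality_dep => i; exact: addxx. Qed.
Fact ai_prod_mulDl (f g h : ai_prod) :
  ((f + g)%R * h)%g = (f * h)%g + (g * h)%g.
Proof. by apply: functional_extensionality_dep => i; exact: ai_mulDl. Qed.
Fact ai_prod_mulDr (f g h : ai_prod) :
  (f * (g + h)%R)%g = (f * g)%g + (f * h)%g.
Proof. by apply: functional_extensionality_dep => i; exact: ai_mulDr. Qed.

HB.instance Definition _ := isAiSemiring.Build ai_prod
  ai_prod_addxx ai_prod_mulDl ai_prod_mulDr.

End Product.

Definition ai_power (S : aiSemiringType) (I : Type) : aiSemiringType :=
  ai_prod (fun _ : I => S).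

Record is_variety (C : aiSemiringType -> Prop) : Prop := IsVariety {
  variety_hom : forall S T : aiSemiringType, C S -> hom_image S T -> C T;
  variety_sub : forall (S : aiSemiringType) (B : subsemiring S),
    C S -> C (subsemiring_type B);
  variety_prod : forall (I : Type) (S : I -> aiSemiringType),
    (forall i, C (S i)) -> C (ai_prod S)
}.

Definition variety_gen (S T : aiSemiringType) : Prop :=
  forall C : aiSemiringType -> Prop, is_variety C -> C S -> C T.

Section Matrices.
Variable S : aiSemiringType.

Definition mx2 : Type := 'M[S]_2.

HB.instance Definition _ := Choice.on mx2.

Definition mx2_add (A B : mx2) : mx2 := \matrix_(i, j) (A i j + B i j).

(* [mulmx] needs a zero in S to define the sum over the middle index. *)
Definition mx2_mul (A B : mx2) : mx2 :=
  \matrix_(i, j) ((A i ord0 * B ord0 j)%g + (A i ord_max * B ord_max j)%g).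

Lemma mx2_addC : commutative mx2_add.
Proof. by move=> A B; apply/matrixP => i j; rewrite !mxE Algebra.addrC. Qed.
Lemma mx2_addA : associative mx2_add.
Proof. by move=> A B C; apply/matrixP => i j; rewrite !mxE Algebra.addrA. Qed.
Lemma mx2_mulA : associative mx2_mul.
Proof.
move=> A B C; apply/matrixP => i j.
by rewrite !mxE !ai_mulDl !ai_mulDr !mulgA Algebra.addrACA.
Qed.

HB.instance Definition _ :=
  Algebra.isAddSemigroup.Build mx2 mx2_addC mx2_addA.
HB.instance Definition _ := isSemigroup.Build mx2 mx2_mulA.

Fact mx2_addxx : idempotent_op (@Algebra.add mx2).
Proof. by move=> A; apply/matrixP => i j; rewrite !mxE addxx. Qed.
Fact mx2_mulDl (A B C : mx2) : ((A + B)%R * C)%g = (A * C)%g + (B * C)%g.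
Proof. by apply/matrixP => i j; rewrite !mxE !ai_mulDl Algebra.addrACA. Qed.
Fact mx2_mulDr (A B C : mx2) : (A * (B + C)%R)%g = (A * B)%g + (A * C)%g.
Proof. by apply/matrixP => i j; rewrite !mxE !ai_mulDr Algebra.addrACA. Qed.

HB.instance Definition _ := isAiSemiring.Build mx2
  mx2_addxx mx2_mulDl mx2_mulDr.

End Matrices.

Variant S7 : Type := S7_one | S7_a | S7_inf.

Definition S7_code (x : S7) : option bool :=
  match x with S7_one => Some true | S7_a => Some false | S7_inf => None end.
Definition S7_decode (x : option bool) : S7 :=
  match x with
  | Some true => S7_one | Some false => S7_a | None => S7_inf
  end.
Lemma S7_codeK : cancel S7_code S7_decode.
Proof. by case. Qed.

HB.instance Definition _ := Finite.copy S7 (can_type S7_codeK).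

Definition S7_add (x y : S7) : S7 := if x == y then x else S7_inf.
Definition S7_mul (x y : S7) : S7 :=
  match x, y with
  | S7_one, z | z, S7_one => z
  | _, _ => S7_inf
  end.

Lemma S7_addC : commutative S7_add.
Proof. by case; case. Qed.
Lemma S7_addA : associative S7_add.
Proof. by case; case; case. Qed.
Lemma S7_mulA : associative S7_mul.
Proof. by case; case; case. Qed.

HB.instance Definition _ :=
  Algebra.isAddSemigroup.Build S7 S7_addC S7_addA.
HB.instance Definition _ := isSemigroup.Build S7 S7_mulA.

Fact S7_addxx : idempotent_op (@Algebra.add S7).
Proof. by case. Qed.
Fact S7_mulDl (x y z : S7) : ((x + y)%R * z)%g = (x * z)%g + (y * z)%g.
Proof. by case: x; case: y; case: z. Qed.
Fact S7_mulDr (x y z : S7) : (x * (y + z)%R)%g = (x * y)%g + (x * z)%g.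
Proof. by case: x; case: y; case: z. Qed.

HB.instance Definition _ := isAiSemiring.Build S7
  S7_addxx S7_mulDl S7_mulDr.

Section Digraphs.
Variables (V : Type) (E : V -> V -> Prop).

Definition out_nbrs (u : V) : set V := [set v | E u v].
Definition in_nbrs (v : V) : set V := [set u | E u v].

Definition isolated (v : V) : Prop :=
  in_nbrs v = set0 /\ out_nbrs v = set0.

Definition in_degree_le1 : Prop := forall v, in_nbrs v #<= `I_1.
Definition out_degree_le1 : Prop := forall u, out_nbrs u #<= `I_1.

Lemma card_le_I1P (A : set V) : A #<= `I_1 -> is_subset1 A.
Proof.
move=> /pcard_leP[f] x y Ax Ay.
have f0 z : A z -> f z = 0%N.
  by move=> Az; have := @funS _ _ _ _ f z Az; rewrite /= ltnS leqn0 => /eqP.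
have fxy : f x = f y by rewrite !f0.
by apply: (@inj _ _ A f) fxy; exact: mem_set.
Qed.

End Digraphs.

Variant graph_elt (V : Type) : Type := Vertex of V | GZero | GOmega.
Arguments GZero {V}.
Arguments GOmega {V}.

(* The degree bounds are needed for distributivity: u(v + w) = u0 = 0, whereas
   uv + uw = omega if v and w are distinct out-neighbours of u. *)
Section GraphSemiring.
Variables (V : Type) (E : V -> V -> Prop).
Hypotheses (Ein : in_degree_le1 E) (Eout : out_degree_le1 E).

Definition graph_semiring of in_degree_le1 E & out_degree_le1 E : Type :=
  graph_elt V.

Local Notation SG := (graph_semiring Ein Eout).

HB.instance Definition _ := gen_eqMixin SG.
HB.instance Definition _ := gen_choiceMixin SG.

Definition graph_add (x y : SG) : SG := if x == y then x else GZero.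
Definition graph_mul (x y : SG) : SG :=
  match x, y with
  | Vertex u, Vertex v => if `[< E u v >] then GOmega else GZero
  | _, _ => GZero
  end.

Lemma graph_addC : commutative graph_add.
Proof. by move=> x y; rewrite /graph_add eq_sym; case: eqP => // ->. Qed.
Lemma graph_addA : associative graph_add.
Proof.
move=> x y z; rewrite /graph_add; have [<-|yz] := eqVneq y z.
  by have [->|xy] := eqVneq x y; [rewrite eqxx | case: ifP].
have [xy|xy] := eqVneq x y; first by rewrite xy (negPf yz); case: eqP.
by case: eqP => [->|_]; case: ifP.
Qed.
Lemma graph_mulA : associative graph_mul.
Proof.
by case=> [u||] [v||] [w||] //=; case: ifP => //; case: ifP.
Qed.

HB.instance Definition _ :=
  Algebra.isAddSemigroup.Build SG graph_addC graph_addA.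
HB.instance Definition _ := isSemigroup.Build SG graph_mulA.

Fact graph_addxx : idempotent_op (@Algebra.add SG).
Proof. by move=> x; rewrite /Algebra.add /= /graph_add eqxx. Qed.

Lemma graph_mul0 (x : SG) : graph_mul x GZero = GZero.
Proof. by case: x. Qed.

Lemma graph_mulDl_aux (x y z : SG) :
  graph_mul (graph_add x y) z = graph_add (graph_mul x z) (graph_mul y z).
Proof.
rewrite {1}/graph_add; have [<-|xy] := eqVneq x y.
  by rewrite /graph_add eqxx.
have -> : graph_mul GZero z = GZero by [].
rewrite /graph_add; case: eqP => // xzyz.
move: x y z xy xzyz => [u||] [v||] [w||] //= uv.
case: asboolP => // Euw; case: asboolP => // Evw _.
have uv' : u = v := card_le_I1P (Ein w) Euw Evw.
by move: uv; rewrite uv' eqxx.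
Qed.

Lemma graph_mulDr_aux (x y z : SG) :
  graph_mul x (graph_add y z) = graph_add (graph_mul x y) (graph_mul x z).
Proof.
rewrite {1}/graph_add; have [<-|yz] := eqVneq y z.
  by rewrite /graph_add eqxx.
rewrite graph_mul0 /graph_add; case: eqP => // xyxz.
move: x y z yz xyxz => [w||] [u||] [v||] //= uv.
case: asboolP => // Ewu; case: asboolP => // Ewv _.
have uv' : u = v := card_le_I1P (Eout w) Ewu Ewv.
by move: uv; rewrite uv' eqxx.
Qed.

Fact graph_mulDl (x y z : SG) : ((x + y)%R * z)%g = (x * z)%g + (y * z)%g.
Proof. exact: graph_mulDl_aux. Qed.
Fact graph_mulDr (x y z : SG) : (x * (y + z)%R)%g = (x * y)%g + (x * z)%g.
Proof. exact: graph_mulDr_aux. Qed.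

HB.instance Definition _ := isAiSemiring.Build SG
  graph_addxx graph_mulDl graph_mulDr.

End GraphSemiring.

(* Main.v *)
Require Import Defs.
From mathcomp Require Import all_boot.
From mathcomp Require Import ssralg matrix boolp classical_sets.

(** Represent a vertex [v], at the labelling [lam], by the upper triangular
    matrix with rows [(p, q)] and [(oo, s)], where [q] encodes the label of
    [v] itself ([a] for true, [1] for false), [p] encodes the opposite of the
    label of the unique successor of [v], and [s] the opposite of the label of
    its unique predecessor; [p] or [s] is [oo] when that neighbour is missing.
    The product of two such matrices has [oo] everywhere except in its upper
    right corner, where it has [p_u q_v + q_u s_v].

    - If [u -> v] is an edge, both summands multiply a label by its opposite,
      so both are [a]: the product is the constant matrix [omega] whose only
      finite entry is an [a] in the corner.
    - If [u -> v] is not an edge, either [p_u = oo], or [u] has a successor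
      [w <> v]; a labelling with [lam v] true and [lam w] false then gives
      [p_u q_v = a a = oo].

    Call a family of matrices null if its corner is [oo] at some labelling.
    Null families absorb both addition and multiplication, and all products
    involving [omega] are null.  The corners of the elements representing
    distinct vertices, or a vertex and [omega], differ at some labelling, so
    the sum of two of these elements is null.  Hence the vertex families,
    [omega] and all the null families form a subsemiring, and collapsing the
    null families to [0] maps it onto the graph semiring. *)

Set Implicit Arguments.
Unset Strict Implicit.
Unset Printing Implicit Defensive.

Local Open Scope classical_set_scope.
Local Open Scope ring_scope.

(** * Homomorphic images of subsemirings *)

(** A relation is convenient here because the homomorphism to be built
    collapses many elements: it avoids defining it by cases on [S]. *)
Lemma hom_image_of_relation (S T : aiSemiringType) (R : T -> S -> Prop) :
    (forall x y f g, R x f -> R y g -> R (x + y) (f + g)) ->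
    (forall x y f g, R x f -> R y g -> R (x * y)%g (f * g)%g) ->
    (forall x y f, R x f -> R y f -> x = y) ->
    (forall x, exists f, R x f) ->
  exists B : subsemiring S, hom_image (subsemiring_type B) T.
Proof.
move=> RD RM Runiq Rsurj.
have BD f g : (exists x, R x f) -> (exists x, R x g) -> exists x, R x (f + g).
  by move=> [x xf] [y yg]; exists (x + y); exact: RD.
have BM f g : (exists x, R x f) -> (exists x, R x g) ->
    exists x, R x (f * g)%g.
  by move=> [x xf] [y yg]; exists (x * y)%g; exact: RM.
pose B := @Subsemiring S [set f | exists x, R x f] BD BM.
pose phi (f : subsemiring_type B) : T := sval (cid (subsemiring_valP f)).
have phiP f : R (phi f) (val f) by rewrite /phi; case: cid.
exists B, phi; split.
  by split=> f g; apply: (Runiq _ _ _ (phiP _)); [exact: RD | exact: RM].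
apply/seteqP; split=> // x _; have [f xf] := Rsurj x.
have Bf : subsemiring_set B f by exists x.
pose f' : subsemiring_type B := exist _ f (mem_set Bf).
by exists f' => //; exact: (Runiq _ _ _ (phiP f') xf).
Qed.

Lemma variety_gen_power (S T : aiSemiringType) (I : Type)
    (B : subsemiring (ai_power S I)) :
  hom_image (subsemiring_type B) T -> variety_gen S T.
Proof.
move=> BT C Cvar CS; apply: (variety_hom Cvar) BT.
by apply: (variety_sub Cvar); apply: (variety_prod Cvar).
Qed.

(** * Upper triangular matrices over S7 *)

Lemma S7_addr_inf (x : S7) : x + S7_inf = S7_inf.
Proof. by case: x. Qed.

Lemma S7_addl_inf (x : S7) : S7_inf + x = S7_inf.
Proof. by case: x. Qed.

Lemma S7_mulr_inf (x : S7) : (x * S7_inf)%g = S7_inf.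
Proof. by case: x. Qed.

Lemma S7_mull_inf (x : S7) : (S7_inf * x)%g = S7_inf.
Proof. by case: x. Qed.

Definition S7_infE := (S7_addr_inf, S7_addl_inf, S7_mulr_inf, S7_mull_inf).

Lemma S7_add_neq (x y : S7) : x <> y -> x + y = S7_inf.
Proof. by case: x; case: y. Qed.

Definition corner (A : mx2 S7) : S7 := A ord0 ord_max.

Lemma cornerD (A B : mx2 S7) : corner (A + B) = corner A + corner B.
Proof. by rewrite /corner mxE. Qed.

Lemma cornerM (A B : mx2 S7) :
  corner (A * B)%g =
  (A ord0 ord0 * corner B)%g + (corner A * B ord_max ord_max)%g.
Proof. by rewrite /corner mxE. Qed.

Definition utri (p q s : S7) : mx2 S7 :=
  \matrix_(i, j) if i == ord0 then if j == ord0 then p else q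
                 else if j == ord0 then S7_inf else s.

Lemma corner_utri p q s : corner (utri p q s) = q.
Proof. by rewrite /corner mxE. Qed.

(** The lower left entry is [oo], not a zero, so it destroys the diagonal of
    any product and leaves the corner alone. *)
Lemma utriM p q s p' q' s' :
  (utri p q s * utri p' q' s')%g =
  utri S7_inf ((p * q')%g + (q * s')%g) S7_inf.
Proof.
apply/matrixP => i j; rewrite !mxE /=.
by case: (i == ord0); case: (j == ord0); rewrite ?S7_infE.
Qed.

(** * Labels *)

Definition label (b : bool) : S7 := if b then S7_a else S7_one.

Lemma label_finite b : label b <> S7_inf.
Proof. by case: b. Qed.

Lemma label_mulN b : (label b * label (~~ b))%g = S7_a.
Proof. by case: b. Qed.

Lemma labelN_mul b : (label (~~ b) * label b)%g = S7_a.
Proof. by case: b. Qed.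

(** Applied to the neighbourhoods [A] of a vertex, which the degree bounds make
    at most singletons: the choice of a point is then harmless.  The value [oo]
    for empty [A] makes a vertex without successor (predecessor) null after
    multiplication on the right (left) by anything. *)
Definition colabel V (A : set V) (lam : V -> bool) : S7 :=
  if pselect (exists v, A v) is left Av then label (~~ lam (sval (cid Av)))
  else S7_inf.

Lemma colabel_eq V (A : set V) lam v :
  is_subset1 A -> A v -> colabel A lam = label (~~ lam v).
Proof.
move=> A1 Av; rewrite /colabel; case: pselect => [Aw|]; last by case; exists v.
by case: cid => w /= Aw'; rewrite (A1 _ _ Aw' Av).
Qed.

Lemma colabel_eq_inf V (A : set V) lam :
  ~ (exists v, A v) -> colabel A lam = S7_inf.
Proof. by rewrite /colabel; case: pselect. Qed.

(** * Representing the graph semiring *)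

Section Representation.
Variables (V : Type) (E : V -> V -> Prop).
Hypotheses (Ein : in_degree_le1 E) (Eout : out_degree_le1 E).

Local Notation SG := (graph_semiring Ein Eout).
Local Notation M := (ai_power (mx2 S7) (V -> bool)).

Definition graph_rep (x : SG) : M := fun lam =>
  match x with
  | Vertex v => utri (colabel (out_nbrs E v) lam) (label (lam v))
                     (colabel (in_nbrs E v) lam)
  | GOmega => utri S7_inf S7_a S7_inf
  | GZero => utri S7_inf S7_inf S7_inf
  end.

Definition null (f : M) : Prop := exists lam, corner (f lam) = S7_inf.

Definition represents (x : SG) (f : M) : Prop :=
  if x is GZero then null f else f = graph_rep x.

Lemma represents_rep x : represents x (graph_rep x).
Proof. by case: x => //=; exists (fun=> true); rewrite corner_utri. Qed.

Lemma nullDl f g : null f -> null (f + g).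
Proof. by move=> [lam f0]; exists lam; rewrite cornerD f0 !S7_infE. Qed.

Lemma nullDr f g : null g -> null (f + g).
Proof. by move=> [lam g0]; exists lam; rewrite cornerD g0 !S7_infE. Qed.

Lemma nullMl f g : null f -> null (f * g)%g.
Proof. by move=> [lam f0]; exists lam; rewrite cornerM f0 !S7_infE. Qed.

Lemma nullMr f g : null g -> null (f * g)%g.
Proof. by move=> [lam g0]; exists lam; rewrite cornerM g0 !S7_infE. Qed.

Lemma represents_null x f : represents x f -> null f -> x = GZero.
Proof.
case: x => [v||] //= -> [lam]; rewrite corner_utri //.
by move=> /label_finite.
Qed.

Lemma rep_add_null (x y : SG) : x <> y -> null (graph_rep x + graph_rep y).
Proof.
have nullP lam : corner (graph_rep x lam) <> corner (graph_rep y lam) ->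
    null (graph_rep x + graph_rep y).
  by exists lam; rewrite cornerD S7_add_neq.
case: x y nullP => [u||] [v||] nullP // xy;
  try by [apply/nullDl/(@represents_rep GZero)
         |apply/nullDr/(@represents_rep GZero)].
- apply: (nullP (fun w => `[< w = u >])); rewrite !corner_utri asboolT //.
  by rewrite asboolF // => vu; apply: xy; rewrite vu.
(* The corner of omega is always [a], which encodes true. *)
- by apply: (nullP (fun=> false)); rewrite !corner_utri.
- by apply: (nullP (fun=> false)); rewrite !corner_utri.
Qed.

Lemma representsD x y f g :
  represents x f -> represents y g -> represents (x + y) (f + g).
Proof.
move=> xf yg; rewrite [(_ + _ : SG)]/(graph_add _ _) /graph_add.
have [xy|/eqP xy] := eqVneq x y.
  rewrite -{}xy in yg; case: x xf yg => [v||] /=.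
  - by move=> -> ->; rewrite addxx.
  - by move=> f0 _; exact: nullDl.
  - by move=> -> ->; rewrite addxx.
by case: x y xf yg xy => [u||] [v||] /= xf yg xy;
  solve [exact: nullDl | exact: nullDr | rewrite xf yg; exact: rep_add_null].
Qed.

Lemma rep_edge u v : E u v ->
  (graph_rep (Vertex u) * graph_rep (Vertex v))%g = graph_rep GOmega.
Proof.
move=> Euv; apply: functional_extensionality_dep => lam.
rewrite [LHS]utriM (colabel_eq _ (card_le_I1P (Eout u)) Euv).
by rewrite (colabel_eq _ (card_le_I1P (Ein v)) Euv) labelN_mul label_mulN.
Qed.

(** A successor [w <> v] of [u] must be separated from [v]: the labelling
    [{v}] makes both factors of the first summand equal to [a]. *)
Lemma rep_nonedge u v : ~ E u v ->
  null (graph_rep (Vertex u) * graph_rep (Vertex v))%g.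
Proof.
move=> nEuv; exists (fun w => `[< w = v >]); rewrite [X in corner X]utriM.
rewrite corner_utri; have [[w Euw]|nout] := pselect (exists w, E u w); last first.
  by rewrite colabel_eq_inf // !S7_infE.
have wv : w <> v by move=> wv; apply: nEuv; rewrite -wv.
rewrite (colabel_eq _ (card_le_I1P (Eout u)) Euw).
by rewrite (asboolT (erefl v)) (asboolF wv) S7_infE.
Qed.

Lemma rep_omegaM x : null (graph_rep GOmega * graph_rep x)%g.
Proof.
exists (fun=> true).
by case: x => [v||]; rewrite [X in corner X]utriM corner_utri !S7_infE.
Qed.

Lemma rep_Momega x : null (graph_rep x * graph_rep GOmega)%g.
Proof.
exists (fun=> true).
by case: x => [v||]; rewrite [X in corner X]utriM corner_utri !S7_infE.
Qed.

Lemma representsM x y f g :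
  represents x f -> represents y g -> represents (x * y)%g (f * g)%g.
Proof.
case: x => [u||] /= xf; [| by move=> _; exact: nullMl |].
- case: y => [v||] /= yg; [| exact: nullMr | by rewrite xf yg; exact: rep_Momega].
  rewrite [(_ * _ : SG)%g]/(graph_mul _ _) /= xf yg.
  by case: asboolP => [/rep_edge|/rep_nonedge].
- by case: y => [v||] /= yg; [| exact: nullMr |];
    rewrite xf yg; exact: rep_omegaM.
Qed.

(** Additivity already forces uniqueness: two distinct elements represented by
    [f] sum to [0], so [f = f + f] is null and represents only [0]. *)
Lemma represents_inj x y f : represents x f -> represents y f -> x = y.
Proof.
move=> xf yf; apply/eqP/negPn/negP => xy.
have := representsD xf yf.
rewrite addxx [(_ + _ : SG)]/(graph_add _ _) /graph_add (negPf xy) => f0.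
by move: xy; rewrite (represents_null xf f0) (represents_null yf f0) eqxx.
Qed.

End Representation.

Theorem theorem6p2 (V : Type) (E : V -> V -> Prop)
    (noiso : forall v : V, ~ isolated E v)
    (Ein : in_degree_le1 E) (Eout : out_degree_le1 E) :
  variety_gen (mx2 S7) (graph_semiring Ein Eout) /\
  (exists B : subsemiring (ai_power (mx2 S7) (V -> bool)),
     hom_image (subsemiring_type B) (graph_semiring Ein Eout)).
Proof.
have [B BG] : exists B : subsemiring (ai_power (mx2 S7) (V -> bool)),
    hom_image (subsemiring_type B) (graph_semiring Ein Eout).
  apply: hom_image_of_relation.
  - exact: representsD.
  - exact: representsM.
  - exact: represents_inj.
  - by move=> x; exists (graph_rep x); exact: represents_rep.
by split; [exact: variety_gen_power BG | exists B].
Qed.
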